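(* Let $C$ be an algebraically closed field of characteristic $0$, let $\{\alpha_i\}_{i\in\mathbb{Z}^+}$ be independent indeterminates over $C$, and let $F = C(\{\alpha_i\}_{i\in \mathbb{Z}^+})$. Let $D$ be the derivation on $F$ determined by $D(c)=0$ for $c\in C$ and $D(\alpha_i)=\alpha_i^3-2\alpha_i^2+2\alpha_i$ for all $i$. Let $R=F[X]$ be the polynomial ring in one variable, let $E=F(X)$ be its quotient field, and extend $D$ to $E$ (and $R$) by setting $D(X)=X^3-2X^2+2X$. Then: (1) the field of constants $\{w\in F : D(w)=0\}$ of $F$ equals $C$; (2) the field of constants $\{w\in E : D(w)=0\}$ of $E$ equals $C$; (3) for every $i$, the ideal $(X-\alpha_i)$ of $R$ is a differential ideal; (4) every finitely generated extension $T$ of $R$ contained in $E$ (that is, every finitely generated $F$-subalgebra $T$ of $E$ with $R\subseteq T\subseteq E$ and $D(T)\subseteq T$) has a nonzero proper differential ideal.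
   Context: A differential ideal of a commutative ring $A$ equipped with a derivation $D$ is an ideal $I$ of $A$ with $D(I)\subseteq I$. An ideal $I$ of $A$ is proper if $I\neq A$. *)

(* Defs.v *)
From HB Require Import structures.
From mathcomp Require Import all_boot all_order all_algebra.
From mathcomp Require Export mpoly.

Set Implicit Arguments.
Unset Strict Implicit.
Unset Printing Implicit Defensive.

Import GRing.Theory.
Local Open Scope ring_scope.

Definition is_derivation (A : comNzRingType) (D : A -> A) : Prop :=
  (forall x y, D (x + y) = D x + D y) /\
  (forall x y, D (x * y) = D x * y + x * D y).

(* The finite initial segments of the family suffice: every finite subfamily
   is contained in one of them. *)
Definition alg_independent (C K : fieldType) (iota : {rmorphism C -> K})
    (a : nat -> K) : Prop :=
  forall (n : nat) (p : {mpoly C[n]}),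
    (map_mpoly iota p).@[fun i : 'I_n => a i] = 0 -> p = 0.

(* [S] is a subalgebra of the [k]-algebra [A] with structure map [j]; it
   contains 1 = j 1. *)
Definition is_subalgebra (k A : comNzRingType) (j : {rmorphism k -> A})
    (S : A -> Prop) : Prop :=
  [/\ forall c, S (j c),
      forall x y, S x -> S y -> S (x - y)
    & forall x y, S x -> S y -> S (x * y)].

Definition is_subextension (k K : fieldType) (j : {rmorphism k -> K})
    (S : K -> Prop) : Prop :=
  is_subalgebra j S /\ (forall x, S x -> S x^-1).

(* K = k({a_i}): the smallest subextension containing all the a_i is K. *)
Definition generates_field (k K : fieldType) (j : {rmorphism k -> K})
    (a : nat -> K) : Prop :=
  forall S : K -> Prop,
    is_subextension j S -> (forall i, S (a i)) -> forall x, S x.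

(* T is the smallest k-subalgebra containing some finite list of elements. *)
Definition is_fin_gen_subalgebra (k A : comNzRingType)
    (j : {rmorphism k -> A}) (T : A -> Prop) : Prop :=
  exists s : seq A, forall x,
    T x <-> (forall S : A -> Prop,
               is_subalgebra j S -> (forall y, y \in s -> S y) -> S x).

(* [I] is an ideal of the subring [T] of [A]; the whole ring is
   [fun _ => True]. Closure under opposites follows from -1 \in T. *)
Definition is_ideal (A : comNzRingType) (T I : A -> Prop) : Prop :=
  [/\ forall x, I x -> T x,
      I 0,
      forall x y, I x -> I y -> I (x + y)
    & forall t x, T t -> I x -> I (t * x)].

(* [D] is a map on [A]; it is meant to preserve [T]. *)
Definition is_differential_ideal (A : comNzRingType) (D : A -> A)
    (T I : A -> Prop) : Prop :=
  is_ideal T I /\ (forall x, I x -> I (D x)).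

Definition proper_in (A : Type) (T I : A -> Prop) : Prop :=
  ~ (forall x, T x <-> I x).

Definition nonzero_ideal (A : comNzRingType) (I : A -> Prop) : Prop :=
  exists x, I x /\ x <> 0.

Definition principal_ideal (A : comNzRingType) (a : A) : A -> Prop :=
  fun x => exists b, x = b * a.

Definition poly_to_frac (F : fieldType) :
    {rmorphism {poly F} -> {fraction {poly F}}} :=
  @tofrac {poly F}.

Definition const_to_frac (F : fieldType) :
    {rmorphism F -> {fraction {poly F}}} :=
  (@tofrac {poly F} \o polyC : F -> {fraction {poly F}}).

(* Main.v *)
Require Import Defs.
From HB Require Import structures.
From mathcomp Require Import all_boot all_order all_algebra ring.

Set Implicit Arguments.
Unset Strict Implicit.
Unset Printing Implicit Defensive.

Import GRing.Theory Num.Theory.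
Local Open Scope ring_scope.

(** Let phi = Y^3 - 2Y^2 + 2Y, with roots 0 and 1 +- i.

    The statements on constants follow from a stronger property, which is the
    one that survives the adjunction of a new solution y of y' = phi(y):
    a nonzero element w with w' = l w, where l is a constant in C, has l = 0
    and lies in C ([has_only_constant_exponentials]).  To see that it passes
    from k to k(y), expand w at a root r of phi.  Since the locus y = r is
    invariant under the derivation, the leading term b (y - r)^m of w
    satisfies (b' + m phi'(r) b) = l b with b in k, so the property of k gives
    l = m phi'(r) and b in C.  Doing this at the two roots 0 and 1 + i gives
    l = 2m = (-2 + 2i) n for integers m and n.  As i is not rational,
    m = n = 0 and l = 0.  Hence any nonzero constant has order 0 at y = 0 and
    has there a value c in C; then w - c is a constant of positive order, so
    w = c.  This is [only_constant_exponentials_adjunction], written with pairs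
    P, Q standing for w = P / Q so that it applies to integral domains.
    Induction on the number of variables gives the property for polynomial
    rings over C ([only_constant_exponentials_mpoly]); F inherits it because
    each of its elements is a quotient of two polynomials in finitely many of
    the alpha_i, and one more adjunction treats F[X], hence E.

    For the last two parts, D(X - alpha_i) = phi(X) - phi(alpha_i) is a
    multiple of X - alpha_i.  If T is finitely generated, then T is contained
    in R[1/g] for one nonzero polynomial g ([fin_gen_denominator]).  The
    alpha_i being distinct, some alpha_i is not a root of g, and then
    X - alpha_i is not invertible in T; it generates the required ideal. *)

(** * Derivations *)

Section Derivation.
Variables (A : comNzRingType) (d : A -> A) (derd : is_derivation d).

Lemma derD x y : d (x + y) = d x + d y. Proof. exact: derd.1. Qed.

Lemma derM x y : d (x * y) = d x * y + x * d y. Proof. exact: derd.2. Qed.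

Lemma der0 : d 0 = 0.
Proof. by apply: (addrI (d 0)); rewrite -derD !addr0. Qed.

Lemma der1 : d 1 = 0.
Proof. by apply: (addrI (d 1)); rewrite addr0 -{3}[1]mulr1 derM mulr1 mul1r. Qed.

Lemma derN x : d (- x) = - d x.
Proof. by apply: (addrI (d x)); rewrite -derD !subrr der0. Qed.

Lemma derB x y : d (x - y) = d x - d y.
Proof. by rewrite derD derN. Qed.

Lemma derXn x n : d (x ^+ n.+1) = (d x * x ^+ n) *+ n.+1.
Proof.
elim: n => [|n IH]; first by rewrite mulr1 mulr1n.
by rewrite exprS derM IH mulrnAr mulrCA -exprS -mulrS.
Qed.

End Derivation.

(** * Exponentials and adjunction of a solution of y' = phi(y) *)

(** For w = P / Q, the hypothesis on P and Q is w' = l w and the conclusion is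
    that l = 0 and that w is in C. *)
Definition has_only_constant_exponentials (C : fieldType) (A : comNzRingType)
    (e : {rmorphism C -> A}) (d : A -> A) : Prop :=
  forall (l : C) (P Q : A), P != 0 -> Q != 0 ->
    d P * Q - P * d Q = e l * P * Q -> l = 0 /\ exists c, P = e c * Q.

Section Adjunction.
Variables (C : fieldType) (A : idomainType) (e : {rmorphism C -> A}).
Variables (d : A -> A).
Hypotheses (derd : is_derivation d) (d_e : forall c, d (e c) = 0).
Variables (phi : {poly C}) (delta : {poly A} -> {poly A}).
Hypotheses (derdelta : is_derivation delta)
  (delta_C : forall a, delta a%:P = (d a)%:P)
  (delta_X : delta 'X = map_poly e phi).

(** The point r is a zero of the vector field phi d/dX, so evaluation at r is
    a morphism of differential rings. *)
Lemma horner_delta_root p r : root phi r -> (delta p).[e r] = d p.[e r].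
Proof.
move=> /rootP phir; elim/poly_ind: p => [|p c IH].
  by rewrite (der0 derdelta) !horner0 (der0 derd).
rewrite (derD derdelta) (derM derdelta) delta_C delta_X !hornerE IH.
rewrite horner_map phir rmorph0 mulr0 addr0.
by rewrite (derD derd) (derM derd) d_e mulr0 addr0.
Qed.

Lemma delta_XsubC_exp r g n : phi = g * ('X - r%:P) ->
  delta (('X - (e r)%:P) ^+ n)
    = n%:R%:P * map_poly e g * ('X - (e r)%:P) ^+ n.
Proof.
move=> phiE; case: n => [|n]; first by rewrite (der1 derdelta) polyC0 !mul0r.
rewrite (derXn derdelta) (derB derdelta) delta_C delta_X d_e polyC0 subr0.
rewrite phiE rmorphM rmorphB /= map_polyX map_polyC /= exprS.
by rewrite -mulr_natl polyC_natr !mulrA.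
Qed.

(** The leading coefficient at X = r of w = u / v is w0 = P(r) / Q(r), and the
    order is a - b.  The logarithmic derivative of X - r takes the value
    phi'(r) at r, so that w0' = (l - (a - b) phi'(r)) w0. *)
Lemma exponential_at_root r a b P Q l :
    has_only_constant_exponentials e d ->
    root phi r -> ~~ root P (e r) -> ~~ root Q (e r) ->
    let u := ('X - (e r)%:P) ^+ a * P in
    let v := ('X - (e r)%:P) ^+ b * Q in
    delta u * v - u * delta v = (e l)%:P * u * v ->
  l = (a%:Z - b%:Z)%:~R * phi^`().[r]
  /\ exists c, P.[e r] = e c * Q.[e r].
Proof.
move=> noexp phir nzP nzQ u v.
have [g phiE] := factor_theorem _ _ phir.
have phi'r : phi^`().[r] = g.[r].
  by rewrite phiE derivM derivXsubC !hornerE subrr mulr0 add0r.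
set L := 'X - (e r)%:P in u v *.
rewrite /u /v (derM derdelta (L ^+ a)) (derM derdelta (L ^+ b)).
rewrite !(delta_XsubC_exp _ phiE) -/L => eq_uv.
have {eq_uv} eqPQ : delta P * Q - P * delta Q
    = ((e l)%:P - (a%:R%:P - b%:R%:P) * map_poly e g) * P * Q.
  apply: (@mulfI _ (L ^+ a * L ^+ b)).
    by rewrite mulf_neq0 // expf_neq0 // polyXsubC_eq0.
  apply/eqP; rewrite -subr_eq0; apply/eqP.
  move/eqP: eq_uv; rewrite -subr_eq0 => /eqP <-; ring.
have /(congr1 (horner^~ (e r))) := eqPQ.
rewrite !hornerE !(horner_delta_root _ phir) horner_map /= -phi'r => eqPQr.
have [|l0 cP] := noexp (l - (a%:Z - b%:Z)%:~R * phi^`().[r]) _ _ nzP nzQ.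
  rewrite eqPQr rmorphB rmorphM rmorph_int /= !rmorphB /=.
  by rewrite -!pmulrn.
by split=> //; apply/eqP; rewrite -subr_eq0 l0.
Qed.

Lemma factor_at (p : {poly A}) x : p != 0 ->
  exists a q, ~~ root q x /\ p = ('X - x%:P) ^+ a * q.
Proof.
move=> nzp; have [a [q]] := multiplicity_XsubC p x.
by rewrite nzp /= => nrq ->; exists a, q; split; last exact: mulrC.
Qed.

(** The orders of w = P / Q at r and s satisfy m phi'(r) = l = n phi'(s), so the
    incommensurability of phi'(r) and phi'(s) forces m = 0 and l = 0. *)
Lemma only_constant_exponentials_adjunction r s :
    root phi r -> root phi s ->
    (forall m n : int,
      m%:~R * phi^`().[r] = n%:~R * phi^`().[s] -> m = 0) ->
    has_only_constant_exponentials e d ->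
  forall e' : {rmorphism C -> {poly A}}, (forall c, e' c = (e c)%:P) ->
  has_only_constant_exponentials e' delta.
Proof.
move=> phir phis incomm noexp e' e'E l P Q nzP nzQ; rewrite e'E => eqPQ.
have [a [P1 [nrP EP]]] := factor_at (e r) nzP.
have [b [Q1 [nrQ EQ]]] := factor_at (e r) nzQ.
have [a' [P2 [nrP2 EP2]]] := factor_at (e s) nzP.
have [b' [Q2 [nrQ2 EQ2]]] := factor_at (e s) nzQ.
have [lr [c Pc]] : l = (a%:Z - b%:Z)%:~R * phi^`().[r]
    /\ exists c, P1.[e r] = e c * Q1.[e r].
  apply: (exponential_at_root (a := a) (b := b) noexp phir nrP nrQ).
  by rewrite -EP -EQ.
have [ls _] : l = (a'%:Z - b'%:Z)%:~R * phi^`().[s]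
    /\ exists c, P2.[e s] = e c * Q2.[e s].
  apply: (exponential_at_root (a := a') (b := b') noexp phis nrP2 nrQ2).
  by rewrite -EP2 -EQ2.
have ab : a%:Z - b%:Z = 0 by apply: (incomm _ (a'%:Z - b'%:Z)); rewrite -lr.
have l0 : l = 0 by rewrite lr ab mul0r.
split=> //; exists c; rewrite e'E; apply/eqP; rewrite -subr_eq0.
apply/negPn/negP => nzS.
(* w - c is again a constant, hence would have order 0 at r, although c was
   chosen to make it vanish there *)
have [k [S1 [nrS ES]]] := factor_at (e r) nzS.
have [] : l = (k%:Z - b%:Z)%:~R * phi^`().[r]
    /\ exists c, S1.[e r] = e c * Q1.[e r].
  apply: (exponential_at_root (a := k) (b := b) noexp phir nrS nrQ); rewrite -ES -EQ.
  rewrite l0 rmorph0 !mul0r in eqPQ *.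
  rewrite (derB derdelta) (derM derdelta) delta_C d_e polyC0 mul0r add0r.
  by rewrite -[RHS]eqPQ; ring.
rewrite l0 => /esym kb _.
have {kb} kb : k%:Z - b%:Z = 0 by apply: (incomm _ 0); rewrite mul0r.
have {}ab : a = b by apply/eqP; rewrite -eqz_nat -subr_eq0 ab.
have {}kb : k = b by apply/eqP; rewrite -eqz_nat -subr_eq0 kb.
case/negP: nrS; apply/rootP.
have -> : S1 = P1 - (e c)%:P * Q1.
  apply: (@mulfI _ (('X - (e r)%:P) ^+ b)).
    by rewrite expf_neq0 // polyXsubC_eq0.
  by rewrite -{1}kb -ES {1}EP ab {1}EQ; ring.
by rewrite !hornerE Pc subrr.
Qed.

End Adjunction.

(** * Extension of a derivation to polynomials *)

Section AdjoinDerivation.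
Variables (A : comNzRingType) (d : A -> A) (derd : is_derivation d).
Variable f : {poly A}.

(** The derivation that extends d and maps the variable to f. *)
Definition adjoin_der (p : {poly A}) : {poly A} :=
  map_poly d p + p^`() * f.

Lemma coef_map_der p i : (map_poly d p)`_i = d p`_i.
Proof. by rewrite coef_map_id0 ?(der0 derd). Qed.

Lemma der_sum (I : Type) (r : seq I) (F : I -> A) :
  d (\sum_(i <- r) F i) = \sum_(i <- r) d (F i).
Proof. exact: (big_morph d (derD derd) (der0 derd)). Qed.

Lemma adjoin_derP : is_derivation adjoin_der.
Proof.
split=> p q; rewrite /adjoin_der.
  have -> : map_poly d (p + q) = map_poly d p + map_poly d q.
    by apply/polyP => i; rewrite !(coefD, coef_map_der) (derD derd).
  by rewrite derivD; ring.
have -> : map_poly d (p * q) = map_poly d p * q + p * map_poly d q.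
  apply/polyP => i; rewrite coefD coef_map_der !coefM der_sum -big_split.
  by apply: eq_bigr => j _; rewrite (derM derd) !coef_map_der.
by rewrite derivM; ring.
Qed.

Lemma adjoin_derC a : adjoin_der a%:P = (d a)%:P.
Proof.
rewrite /adjoin_der derivC mul0r addr0; apply/polyP => i.
by rewrite coef_map_der !coefC; case: eqP => // _; rewrite (der0 derd).
Qed.

Lemma adjoin_derX : adjoin_der 'X = f.
Proof.
rewrite /adjoin_der derivX mul1r -[RHS]add0r; congr (_ + _); apply/polyP => i.
by rewrite coef_map_der coefX coef0; case: eqP; rewrite ?(der1 derd) ?(der0 derd).
Qed.

(** The three properties determine the derivation; stating them with a bound
    variable keeps later conversions from unfolding [adjoin_der]. *)
Lemma adjoin_der_exists : exists delta : {poly A} -> {poly A},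
  [/\ is_derivation delta, forall a, delta a%:P = (d a)%:P & delta 'X = f].
Proof.
exists adjoin_der.
split; [exact: adjoin_derP|exact: adjoin_derC|exact: adjoin_derX].
Qed.

End AdjoinDerivation.

(** * Polynomials in finitely many solutions *)

Section PolynomialInduction.
Variables (R : comNzRingType) (n : nat).

Lemma mpoly_ring_ind (P : {mpoly R[n]} -> Prop) :
    (forall c, P c%:MP) -> (forall i, P 'X_i) ->
    (forall p q, P p -> P q -> P (p + q)) ->
    (forall p q, P p -> P q -> P (p * q)) ->
  forall p, P p.
Proof.
move=> PC PX PD PM; elim/mpolyind => [|c m p _ _ Pp]; first exact: (PC 0).
apply: (PD _ _ _ Pp); rewrite -mul_mpolyC; apply: (PM _ _ (PC c)).
rewrite mpolyXE_id; apply: (big_ind P) => [|x y Px Py|i _].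
- exact: (PC 1).
- exact: PM.
elim: (m i) => [|k IH]; first exact: (PC 1).
by rewrite exprS; apply: PM.
Qed.

Lemma mpoly_rmorph_ext (S : comNzRingType) (f g : {rmorphism {mpoly R[n]} -> S}) :
    (forall c, f c%:MP = g c%:MP) -> (forall i, f 'X_i = g 'X_i) ->
  f =1 g.
Proof.
move=> eqC eqX; elim/mpoly_ring_ind => // p q IHp IHq.
  by rewrite (rmorphD f) (rmorphD g) IHp IHq.
by rewrite (rmorphM f) (rmorphM g) IHp IHq.
Qed.

End PolynomialInduction.

Section AutonomousSystem.
Variables (C : fieldType) (phi : {poly C}).

(** The vector field sum_i phi(X_i) d/dX_i, for which every variable is a
    solution of y' = phi(y). *)
Definition autonomous_der n (p : {mpoly C[n]}) : {mpoly C[n]} :=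
  \sum_(i < n) (map_poly (@mpolyC n C) phi).['X_i] * p^`M(i).

Lemma autonomous_derP n : is_derivation (@autonomous_der n).
Proof.
split=> p q; rewrite /autonomous_der.
  by rewrite -big_split; apply: eq_bigr => i _; rewrite mderivD mulrDr.
rewrite mulr_suml mulr_sumr -big_split; apply: eq_bigr => i _ /=.
by rewrite mderivM; ring.
Qed.

Lemma autonomous_derC n c : @autonomous_der n c%:MP = 0.
Proof. by rewrite /autonomous_der big1 // => i _; rewrite mderivC mulr0. Qed.

Lemma autonomous_derX n i :
  @autonomous_der n 'X_i = (map_poly (@mpolyC n C) phi).['X_i].
Proof.
rewrite /autonomous_der (bigD1 i) //= big1 => [|j ji]; rewrite mderivX mnm1E.
  rewrite eqxx addr0 scale1r (_ : _ - _ = 0)%MM ?mpolyX0 ?mulr1 //.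
  by apply/mnmP => k; rewrite mnmBE subnn mnm0E.
by rewrite eq_sym (negPf ji) scale0r mulr0.
Qed.

(** Two derivations along f that agree on constants and variables agree. *)
Lemma autonomous_der_morph n (K : comNzRingType) (d : K -> K)
    (f : {rmorphism {mpoly C[n]} -> K}) :
    is_derivation d -> (forall c, d (f c%:MP) = 0) ->
    (forall i, d (f 'X_i) = (map_poly (f \o @mpolyC n C) phi).[f 'X_i]) ->
  forall p, d (f p) = f (autonomous_der p).
Proof.
move=> derd dC dX; have derA := @autonomous_derP n.
elim/mpoly_ring_ind => [c|i|p q IHp IHq|p q IHp IHq].
- by rewrite dC autonomous_derC rmorph0.
- by rewrite dX autonomous_derX -horner_map /= -map_poly_comp.
- by rewrite rmorphD (derD derd) (derD derA) IHp IHq rmorphD.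
- by rewrite rmorphM (derM derd) (derM derA) IHp IHq rmorphD !rmorphM.
Qed.

Lemma muniX_max n : muni ('X_ord_max : {mpoly C[n.+1]}) = 'X.
Proof.
rewrite muniE msuppX big_seq1 mcoeffX eqxx scale1r mnm1E eqxx expr1.
rewrite (_ : [multinom _ | _ < n] = 0%MM) ?mpolyX0 ?scale1r //.
apply/mnmP => j; rewrite mnmE mnm1E mnm0E -val_eqE /=.
by rewrite gtn_eqF.
Qed.

Lemma muniX_widen n (i : 'I_n) :
  muni ('X_(widen_ord (leqnSn n) i) : {mpoly C[n.+1]}) = ('X_i)%:P.
Proof.
rewrite muniE msuppX big_seq1 mcoeffX eqxx scale1r mnm1E -val_eqE /= ltn_eqF //.
rewrite expr0 alg_polyC; congr (_%:P); congr 'X_[_].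
by apply/mnmP => j; rewrite mnmE !mnm1E -val_eqE.
Qed.

(** The case distinction on i that matches the values of [muni]. *)
Lemma ord_last_ind n (P : 'I_n.+1 -> Prop) :
  P ord_max -> (forall i : 'I_n, P (widen_ord (leqnSn n) i)) -> forall i, P i.
Proof.
move=> Pmax Pw i; case: (unliftP ord_max i) => [j|] -> //.
by have -> : lift ord_max j = widen_ord (leqnSn n) j by apply/val_inj/lift_max.
Qed.

(** Substituting the last variable for the polynomial variable is a left
    inverse of [muni]. *)
Lemma muni_inj n : injective (@muni n C).
Proof.
pose back : {rmorphism {poly {mpoly C[n]}} -> {mpoly C[n.+1]}} :=
  horner_eval 'X_ord_max \o map_poly (@mwiden n C).
pose idm : {rmorphism {mpoly C[n.+1]} -> {mpoly C[n.+1]}} := idfun.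
apply: (can_inj (g := back)) => p.
apply: (mpoly_rmorph_ext (f := back \o @muni n C) (g := idm)) => [c|i] /=.
  by rewrite muniC /horner_eval map_polyC hornerC /= mwidenC.
elim/ord_last_ind: i => [|i].
  by rewrite /horner_eval muniX_max map_polyX hornerX.
by rewrite /horner_eval muniX_widen map_polyC hornerC /= mwidenX mnmwiden1.
Qed.

(** As for [adjoin_der_exists], a bound variable keeps conversion away from the
    expansion of [muni]. *)
Lemma split_last_variable n :
  exists mu : {rmorphism {mpoly C[n.+1]} -> {poly {mpoly C[n]}}},
  [/\ forall c, mu c%:MP = (c%:MP)%:P, mu 'X_ord_max = 'X,
      forall i, mu 'X_(widen_ord (leqnSn n) i) = ('X_i)%:P & injective mu].
Proof.
exists (@muni n C).
split; [exact: muniC|exact: muniX_max|exact: muniX_widen|exact: muni_inj].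
Qed.

(** Each variable is adjoined to the polynomials in the previous ones. *)
Lemma only_constant_exponentials_mpoly r s :
    root phi r -> root phi s ->
    (forall m n : int,
      m%:~R * phi^`().[r] = n%:~R * phi^`().[s] -> m = 0) ->
  forall n, has_only_constant_exponentials (@mpolyC n C) (@autonomous_der n).
Proof.
move=> phir phis incomm; elim=> [|n IH] l P Q nzP nzQ.
  (* no variable: P and Q are constants, and the derivation vanishes *)
  move: nzP nzQ; rewrite (nvar0_mpolyC P) (nvar0_mpolyC Q) !mpolyC_eq0.
  set x := P@__; set y := Q@__ => nzx nzy; rewrite !autonomous_derC mul0r mulr0 subrr.
  rewrite -!mpolyCM => /esym/eqP.
  rewrite mpolyC_eq0 !mulf_eq0 (negPf nzx) (negPf nzy) !orbF => /eqP l0.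
  by split=> //; exists (x / y); rewrite -mpolyCM divfK.
have derA := @autonomous_derP n.
have [delta [derdelta deltaC deltaX]] :=
  adjoin_der_exists derA (map_poly (@mpolyC n C) phi).
have [mu [muC mu_max mu_widen mu_inj]] := split_last_variable n.
have mu_der p : delta (mu p) = mu (autonomous_der p).
  apply: autonomous_der_morph derdelta _ _ p => [c|i].
    by rewrite muC deltaC autonomous_derC.
  have -> : map_poly (mu \o @mpolyC n.+1 C) phi
      = map_poly polyC (map_poly (@mpolyC n C) phi).
    by rewrite -map_poly_comp; apply: eq_map_poly => c; exact: muC.
  elim/ord_last_ind: i => [|i].
    by rewrite mu_max deltaX -[LHS]comp_polyXr.
  by rewrite mu_widen deltaC autonomous_derX horner_map.
move=> eqPQ.
have mu_neq0 p : p != 0 -> mu p != 0.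
  by rewrite -(rmorph0 mu) (inj_eq mu_inj).
have eq_mu : delta (mu P) * mu Q - mu P * delta (mu Q)
    = (l%:MP)%:P * mu P * mu Q.
  by rewrite !mu_der -!(rmorphM mu) -(rmorphB mu) eqPQ !(rmorphM mu) muC.
have [l0 [c cPQ]] := only_constant_exponentials_adjunction derA
  (@autonomous_derC n) derdelta deltaC deltaX phir phis incomm IH
  (e' := polyC \o @mpolyC n C) (fun=> erefl) (mu_neq0 _ nzP) (mu_neq0 _ nzQ)
  eq_mu.
by split=> //; exists c; apply: mu_inj; rewrite cPQ (rmorphM mu) muC.
Qed.
End AutonomousSystem.

(** * Fraction fields and the field generated by the solutions *)

Section FractionField.
Variables (R : idomainType).

Lemma fraction_eq (x : {fraction R}) :
  exists u v : R, v != 0 /\ x = tofrac u / tofrac v.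
Proof.
elim/quotW: x => x; exists \n_x, \d_x; split; first exact: denom_ratioP.
have nzd : tofrac \d_x != 0 :> {fraction R} by rewrite tofrac_eq0 denom_ratioP.
apply: (mulIf nzd); rewrite divfK //; unlock tofrac.
rewrite -[LHS]FracField.pi_mul; apply/eqmodP => /=.
rewrite FracField.equivfE /FracField.mulf !numden_Ratio ?oner_neq0 ?mulr1 //;
  try exact: denom_ratioP.
by rewrite mulrC.
Qed.

End FractionField.

Section Fields.
Variables (C : fieldType) (F : fieldType) (iota : {rmorphism C -> F}).

Lemma eval_exists (alpha : nat -> F) n :
    alg_independent iota alpha ->
  exists ev : {rmorphism {mpoly C[n]} -> F},
  [/\ forall c, ev c%:MP = iota c, forall i, ev 'X_i = alpha i & injective ev].
Proof.
move=> indep.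
pose v (i : 'I_n) := alpha i.
pose ev : {rmorphism {mpoly C[n]} -> F} := meval v \o map_mpoly iota.
exists ev; split=> [c|i|].
- by rewrite /ev /= map_mpolyC mevalC.
- by rewrite /ev /= map_mpolyX mevalXU.
apply/(raddf_inj (f := ev)) => p; exact: indep.
Qed.

Lemma generator_inj (alpha : nat -> F) :
  alg_independent iota alpha -> injective alpha.
Proof.
move=> indep i j eq_ij.
have [ev [_ evX ev_inj]] := eval_exists (maxn i j).+1 indep.
have lti : (i < (maxn i j).+1)%N by rewrite ltnS leq_maxl.
have ltj : (j < (maxn i j).+1)%N by rewrite ltnS leq_maxr.
have eqX : 'X_(Ordinal lti) = 'X_(Ordinal ltj) :> {mpoly C[(maxn i j).+1]}.
  by apply: ev_inj; rewrite !evX.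
have /(congr1 (@meval _ _ (fun k => (val k == i)%:R))) := eqX.
rewrite !mevalXU /= eqxx; case: eqP => // _ /esym/eqP.
by rewrite eq_sym oner_eq0.
Qed.

Lemma subext_ring_closed (S : F -> Prop) : is_subextension iota S ->
  [/\ forall c, S (iota c), forall x y, S x -> S y -> S (x + y)
    & forall x y, S x -> S y -> S (x * y)].
Proof.
move=> [[SC SB SM] _]; split=> // x y Sx Sy.
have S0 : S 0 by rewrite -(rmorph0 iota).
by rewrite -[y]opprK -[- y]sub0r; apply: (SB) => //; apply: (SB).
Qed.

(** The quotients of polynomials in the first n generators form a subextension,
    which grows with n; so their union is one, and it contains all generators. *)
Lemma finitely_many_generators (alpha : nat -> F) :
    alg_independent iota alpha -> generates_field iota alpha ->
  forall w, exists n (ev : {rmorphism {mpoly C[n]} -> F}),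
  [/\ forall c, ev c%:MP = iota c, forall i, ev 'X_i = alpha i, injective ev
    & exists P Q, Q != 0 /\ w = ev P / ev Q].
Proof.
move=> indep gen.
pose S n w := exists ev : {rmorphism {mpoly C[n]} -> F},
  [/\ forall c, ev c%:MP = iota c, forall i, ev 'X_i = alpha i, injective ev
    & exists P Q, Q != 0 /\ w = ev P / ev Q].
have S_subext n : is_subextension iota (S n).
  have [ev [evC evX ev_inj]] := eval_exists n indep.
  have nz Q : Q != 0 -> ev Q != 0 by rewrite -(rmorph0 ev) (inj_eq ev_inj).
  have inS w : S n w <-> exists P Q, Q != 0 /\ w = ev P / ev Q.
    split=> [[ev' [evC' evX' _ [P [Q [nzQ ->]]]]]|ex]; last by exists ev.
    have ee : ev' =1 ev.
      by apply: mpoly_rmorph_ext => [c|i]; rewrite ?evC ?evC' ?evX ?evX'.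
    by exists P, Q; rewrite !ee.
  split; first split.
  - move=> c; apply/inS; exists c%:MP, 1; rewrite oner_neq0 evC rmorph1 divr1.
    by split.
  - move=> x y /inS [P [Q [nzQ ->]]] /inS [P' [Q' [nzQ' ->]]]; apply/inS.
    exists (P * Q' - P' * Q), (Q * Q'); split; first exact: mulf_neq0.
    rewrite (rmorphB ev) !(rmorphM ev).
    by field; rewrite !nz.
  - move=> x y /inS [P [Q [nzQ ->]]] /inS [P' [Q' [nzQ' ->]]]; apply/inS.
    exists (P * P'), (Q * Q'); split; first exact: mulf_neq0.
    rewrite !(rmorphM ev).
    by field; rewrite !nz.
  move=> x /inS [P [Q [nzQ ->]]]; apply/inS.
  have [P0|nzP] := eqVneq P 0.
    by exists 0, 1; rewrite P0 rmorph0 !mul0r invr0 oner_neq0.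
  by exists Q, P; rewrite invf_div.
have S_alpha n i : (i < n)%N -> S n (alpha i).
  move=> lt_in; have [ev [evC evX ev_inj]] := eval_exists n indep.
  exists ev; split=> //; exists 'X_(Ordinal lt_in), 1.
  by rewrite oner_neq0 rmorph1 divr1 evX.
have S_mono n m w : (n <= m)%N -> S n w -> S m w.
  move=> le_nm [ev [evC evX _ [P [Q [_ ->]]]]].
  have [[_ _ SM] SV] := S_subext m.
  have [SC SD _] := subext_ring_closed (S_subext m).
  have Sev p : S m (ev p).
    elim/mpoly_ring_ind: p => [c|i|p q Sp Sq|p q Sp Sq].
    - by rewrite evC.
    - by rewrite evX; apply: S_alpha; apply: leq_trans le_nm.
    - by rewrite (rmorphD ev); apply: SD.
    - by rewrite (rmorphM ev); apply: SM.
  by apply: SM => //; apply: SV.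
apply: gen => [|i]; last by exists i.+1; apply: S_alpha.
have join x y : (exists n, S n x) -> (exists n, S n y) ->
    exists n, S n x /\ S n y.
  move=> [n Sx] [m Sy]; exists (maxn n m).
  by split; [apply: S_mono Sx; apply: leq_maxl|apply: S_mono Sy; apply: leq_maxr].
split; first split.
- by move=> c; exists 0%N; have [[SC _ _] _] := S_subext 0%N; apply: SC.
- move=> x y Sx Sy; have [n [Sxn Syn]] := join _ _ Sx Sy.
  by exists n; have [[_ SB _] _] := S_subext n; apply: SB.
- move=> x y Sx Sy; have [n [Sxn Syn]] := join _ _ Sx Sy.
  by exists n; have [[_ _ SM] _] := S_subext n; apply: SM.
by move=> x [n Sx]; exists n; have [_ SV] := S_subext n; apply: SV.
Qed.

(** If x' y - x y' = l x y and x / y = P / Q then P' Q - P Q' = l P Q, so the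
    question about F is one about polynomials in finitely many generators. *)
Lemma only_constant_exponentials_generated (alpha : nat -> F) (D : F -> F)
    (phi : {poly C}) r s :
    alg_independent iota alpha -> generates_field iota alpha ->
    is_derivation D -> (forall c, D (iota c) = 0) ->
    (forall i, D (alpha i) = (map_poly iota phi).[alpha i]) ->
    root phi r -> root phi s ->
    (forall m n : int,
      m%:~R * phi^`().[r] = n%:~R * phi^`().[s] -> m = 0) ->
  has_only_constant_exponentials iota D.
Proof.
move=> indep gen derF D_C D_alpha phir phis incomm l x y nzx nzy eqxy.
have [n [ev [evC evX ev_inj [P [Q [nzQ xyE]]]]]] :=
  finitely_many_generators indep gen (x / y).
have nz R : R != 0 -> ev R != 0 by rewrite -(rmorph0 ev) (inj_eq ev_inj).
have nzP : P != 0.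
  apply/eqP => P0; move/eqP: xyE.
  by rewrite P0 rmorph0 mul0r mulf_eq0 invr_eq0 (negPf nzx) (negPf nzy).
have D_ev p : D (ev p) = ev (autonomous_der phi p).
  apply: autonomous_der_morph derF _ _ p => [c|i]; first by rewrite evC.
  rewrite evX D_alpha; congr (_.[_]).
  by apply: eq_map_poly => c; rewrite /= evC.
have cross : x * ev Q = y * ev P.
  have -> : x = ev P / ev Q * y by rewrite -xyE divfK.
  by field; rewrite nz.
have dcross : D x * ev Q + x * D (ev Q) = D y * ev P + y * D (ev P).
  by rewrite -!(derM derF) cross.
(* w' = l w for w = x / y = P / Q, without quotients: multiply by y^2 and
   use x Q = y P together with its derivative *)
have eqPQ : autonomous_der phi P * Q - P * autonomous_der phi Q
    = l%:MP * P * Q.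
  apply: ev_inj; rewrite (rmorphB ev) !(rmorphM ev) -!D_ev evC.
  apply: (mulfI (mulf_neq0 nzy nzy)).
  have e1 : y * D (ev P) = D x * ev Q + x * D (ev Q) - D y * ev P.
    by rewrite dcross; ring.
  transitivity ((y * D (ev P)) * y * ev Q - y * (y * ev P) * D (ev Q)).
    by ring.
  rewrite e1 -cross.
  transitivity (D x * y * ev Q * ev Q - D y * (y * ev P) * ev Q); first by ring.
  rewrite -cross; transitivity ((D x * y - x * D y) * ev Q ^+ 2); first by ring.
  rewrite eqxy; transitivity (iota l * y * ev Q * (x * ev Q)); first by ring.
  by rewrite cross; ring.
have [l0 [c PcQ]] := only_constant_exponentials_mpoly phir phis incomm
  nzP nzQ eqPQ.
split=> //; exists c; apply: (mulIf (nz _ nzQ)).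
by rewrite cross PcQ (rmorphM ev) evC; ring.
Qed.

End Fields.

(** * The cubic Y^3 - 2Y^2 + 2Y *)

Section SpecialCubic.
Variables (C : closedFieldType).

Definition cubic : {poly C} := 'X ^+ 3 - 2 * 'X ^+ 2 + 2 * 'X.

Lemma map_cubic (A : comNzRingType) (e : {rmorphism C -> A}) :
  map_poly e cubic = 'X ^+ 3 - 2 * 'X ^+ 2 + 2 * 'X.
Proof.
by rewrite /cubic rmorphD rmorphB !rmorphM /= map_polyX rmorph_nat.
Qed.

(** The derivative of the cubic is 2 at the root 0 and -2 + 2i at the root
    1 + i; a relation 2m = (-2 + 2i) n gives m + n = n i, hence the relation
    (m + n)^2 + n^2 = 0 between integers. *)
Lemma cubic_incommensurable : [pchar C] =i pred0 ->
  exists r s, [/\ root cubic r, root cubic s &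
    forall m n : int,
      m%:~R * cubic^`().[r] = n%:~R * cubic^`().[s] -> m = 0].
Proof.
move=> char0.
have int_eq0 (m : int) : m%:~R = 0 :> C -> m = 0.
  have nat_eq0 := (pcharf0P C).1 char0.
  case: m => k; first by move/eqP; rewrite nat_eq0 => /eqP ->.
  by rewrite NegzE mulrNz => /eqP; rewrite oppr_eq0 nat_eq0.
have [i i2] : exists i : C, i ^+ 2 = -1.
  have [i] := @solve_monicpoly C 2 (fun k => if k == 0%N then -1 else 0) isT.
  by rewrite !big_ord_recl big_ord0 /= mul0r !addr0 mulr1 => i2; exists i.
have val x : cubic.[x] = x ^+ 3 - 2 * x ^+ 2 + 2 * x.
  rewrite /cubic !mulr_natl.
  by rewrite !(hornerD, hornerN, hornerMn, hornerXn, hornerX).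
have der x : cubic^`().[x] = 3 * x ^+ 2 - 4 * x + 2.
  by rewrite /cubic !mulr_natl !derivE /= !(hornerD, hornerN, hornerMn, hornerXn, hornerX, hornerC); ring.
exists 0, (1 + i); split.
- by apply/rootP; rewrite val; ring.
- apply/rootP; rewrite val.
  by transitivity ((1 + i) * (i ^+ 2 + 1)); [ring|rewrite i2 addNr mulr0].
move=> m n; rewrite !der => eq_mn.
have nz2 : (2 : C) != 0.
  by apply/eqP => two0; have := int_eq0 2 two0.
have {eq_mn} eq_mn : (m + n)%:~R = n%:~R * i.
  apply: (mulfI nz2); rewrite rmorphD /=.
  transitivity (m%:~R * (3 * 0 ^+ 2 - 4 * 0 + 2) + 2 * n%:~R : C); first by ring.
  rewrite eq_mn.
  transitivity (2 * (n%:~R * i) + 3 * n%:~R * (i ^+ 2 + 1)); first by ring.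
  by rewrite i2 addNr mulr0 addr0.
have sq0 : (m + n) ^+ 2 + n ^+ 2 = 0.
  apply: int_eq0; rewrite rmorphD !rmorphXn /= eq_mn exprMn i2; ring.
move/eqP: sq0; rewrite paddr_eq0 ?sqr_ge0 // !sqrf_eq0 => /andP[/eqP + /eqP n0].
by rewrite n0 addr0.
Qed.

End SpecialCubic.

(** * Constants, differential ideals and denominators *)

Section Differential.
Variables (F : fieldType) (D : F -> F).

Lemma constants_of_only_constant_exponentials (C : fieldType)
    (e : {rmorphism C -> F}) :
  (forall c, D (e c) = 0) -> is_derivation D ->
  has_only_constant_exponentials e D ->
  forall w, D w = 0 <-> exists c, w = e c.
Proof.
move=> De derF only w; split=> [Dw|[c ->] //].
have [->|nzw] := eqVneq w 0; first by exists 0; rewrite rmorph0.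
have [|_ [c ->]] := only 0 w 1 nzw (oner_neq0 _).
  by rewrite Dw (der1 derF) rmorph0 !mul0r mulr0 subrr.
by exists c; rewrite mulr1.
Qed.

Lemma constants_of_fraction (C : fieldType) (R : idomainType)
    (e : {rmorphism C -> R}) (d : R -> R) (dE : {fraction R} -> {fraction R}) :
  is_derivation dE -> (forall p, dE (tofrac p) = tofrac (d p)) ->
  has_only_constant_exponentials e d ->
  forall w, dE w = 0 -> exists c, w = tofrac (e c).
Proof.
move=> derE dER only w.
have [P [Q [nzQ ->]]] := fraction_eq w => dw0.
have nzQF : tofrac Q != 0 :> {fraction R} by rewrite tofrac_eq0.
have [->|nzP] := eqVneq P 0; first by exists 0; rewrite rmorph0 tofrac0 mul0r.
have [|_ [c ->]] := only 0 P Q nzP nzQ.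
  rewrite rmorph0 !mul0r; apply/eqP; rewrite -tofrac_eq0 tofracB !tofracM -!dER.
  rewrite -{1}(divfK nzQF (tofrac P)) (derM derE) dw0 mul0r add0r.
  by rewrite mulrAC divfK // subrr.
by exists c; rewrite tofracM mulfK.
Qed.

Lemma horner_sub_factor (p : {poly F}) a :
  exists q, p - p.[a]%:P = q * ('X - a%:P).
Proof. by apply/factor_theorem/rootP; rewrite !hornerE subrr. Qed.

Lemma principal_differential_ideal (A : comNzRingType) (d : A -> A)
    (T : A -> Prop) a q :
  is_derivation d ->
  (forall x y, T x -> T y -> T (x + y)) -> (forall x y, T x -> T y -> T (x * y)) ->
  (forall x, T x -> T (d x)) ->
  T 0 -> T a -> T q -> d a = q * a ->
  is_differential_ideal d T (fun x => exists2 t, T t & x = t * a).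
Proof.
move=> derd TD TM Td T0 Ta Tq da; split; first split.
- by move=> x [t Tt ->]; apply: TM.
- by exists 0; rewrite ?mul0r.
- by move=> x y [t Tt ->] [u Tu ->]; exists (t + u); [exact: TD|rewrite mulrDl].
- by move=> t x Tt [u Tu ->]; exists (t * u); [exact: TM|rewrite mulrA].
move=> x [t Tt ->]; exists (d t + t * q); first by apply: (TD); auto.
by rewrite (derM derd) da; ring.
Qed.

Lemma common_denominator (s : seq {fraction {poly F}}) :
  exists2 g : {poly F}, g != 0 &
    forall y, y \in s -> exists p, y * tofrac g = tofrac p.
Proof.
elim: s => [|x s [g nzg IH]]; first by exists 1; rewrite ?oner_neq0.
have [u [v [nzv ->]]] := fraction_eq x.
have nzvF : tofrac v != 0 :> {fraction {poly F}} by rewrite tofrac_eq0.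
exists (v * g); first exact: mulf_neq0.
move=> y; rewrite in_cons => /orP[/eqP ->|/IH [p yp]].
  by exists (u * g); rewrite !tofracM mulrA divfK.
by exists (v * p); rewrite !tofracM mulrCA yp.
Qed.

(** The elements of E that some power of g multiplies into F[X] form the
    subalgebra R[1/g], which contains the generators of T. *)
Lemma fin_gen_denominator (T : {fraction {poly F}} -> Prop) :
  is_fin_gen_subalgebra (const_to_frac F) T ->
  exists2 g : {poly F}, g != 0 &
    forall x, T x -> exists n p, x * tofrac (g ^+ n) = tofrac p.
Proof.
move=> [s Ts]; have [g nzg gs] := common_denominator s; exists g => // x /Ts Tx.
apply: (Tx (fun y => exists n p, y * tofrac (g ^+ n) = tofrac p)) => [|y /gs [p yp]]; last by exists 1%N, p; rewrite expr1.
split=> [c|y z [n [p yp]] [m [q zq]]|y z [n [p yp]] [m [q zq]]].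
- by exists 0%N, c%:P; rewrite expr0 tofrac1 mulr1.
- exists (n + m)%N, (p * g ^+ m - q * g ^+ n).
  by rewrite exprD tofracB !tofracM -yp -zq; ring.
- exists (n + m)%N, (p * q).
  by rewrite exprD !tofracM -yp -zq; ring.
Qed.

(** Among the first size g values of alpha, not all are roots of g. *)
Lemma exists_nonroot (alpha : nat -> F) (g : {poly F}) :
  injective alpha -> g != 0 -> exists i, ~~ root g (alpha i).
Proof.
move=> inj nzg; pose rs := [seq alpha i | i <- iota 0 (size g)].
have [/hasP [_ /mapP [i _ ->] nr]|] := boolP (has (fun x => ~~ root g x) rs).
  by exists i.
rewrite -all_predC => all_r.
have := @max_poly_roots _ g rs nzg.
rewrite map_inj_uniq // iota_uniq size_map size_iota ltnn.
by rewrite (eq_all (a2 := root g)) in all_r => [/(_ all_r isT)|x /=]; rewrite ?negbK.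
Qed.

End Differential.

Theorem mainTheorem1
  (C : closedFieldType) (charC0 : [pchar C] =i pred0)
  (* F = C({alpha_i}), the alpha_i being independent indeterminates *)
  (F : fieldType) (iota : {rmorphism C -> F}) (alpha : nat -> F)
  (alpha_indep : alg_independent iota alpha)
  (alpha_gen : generates_field iota alpha)
  (D : F -> F) (derD : is_derivation D)
  (D_C : forall c : C, D (iota c) = 0)
  (D_alpha : forall i, D (alpha i) = alpha i ^+ 3 - 2 * alpha i ^+ 2 + 2 * alpha i)
  (* the extension of D to R = F[X] *)
  (DR : {poly F} -> {poly F}) (derDR : is_derivation DR)
  (DR_F : forall a : F, DR a%:P = (D a)%:P)
  (DR_X : DR 'X = 'X ^+ 3 - 2 * 'X ^+ 2 + 2 * 'X)
  (* the extension of DR to E = F(X) *)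
  (DE : {fraction {poly F}} -> {fraction {poly F}}) (derDE : is_derivation DE)
  (DE_R : forall p : {poly F}, DE (poly_to_frac F p) = poly_to_frac F (DR p)) :
  [/\ (forall w : F, D w = 0 <-> exists c : C, w = iota c),
      (forall w : {fraction {poly F}},
         DE w = 0 <-> exists c : C, w = const_to_frac F (iota c)),
      (forall i : nat,
         is_differential_ideal DR (fun _ => True)
           (principal_ideal ('X - (alpha i)%:P)))
    & (forall T : {fraction {poly F}} -> Prop,
         is_subalgebra (const_to_frac F) T ->
         is_fin_gen_subalgebra (const_to_frac F) T ->
         (forall p : {poly F}, T (poly_to_frac F p)) ->
         (forall x, T x -> T (DE x)) ->
         exists I : {fraction {poly F}} -> Prop,
           [/\ is_differential_ideal DE T I,
               nonzero_ideal I
             & proper_in T I])].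
Proof.
have [r [s [rootr roots incomm]]] := cubic_incommensurable charC0.
have F_only : has_only_constant_exponentials iota D.
  apply: only_constant_exponentials_generated alpha_indep alpha_gen derD D_C _
    rootr roots incomm => i.
  by rewrite D_alpha map_cubic !hornerE.
pose iotaP : {rmorphism C -> {poly F}} := polyC \o iota.
have R_only : has_only_constant_exponentials iotaP DR.
  have DR_X' : DR 'X = map_poly iota (cubic C) by rewrite map_cubic.
  exact (only_constant_exponentials_adjunction derD D_C derDR DR_F DR_X'
    rootr roots incomm F_only (e' := iotaP) (fun=> erefl)).
have DR_XsubC i : exists q, DR ('X - (alpha i)%:P) = q * ('X - (alpha i)%:P).
  have [q eq_q] := horner_sub_factor (DR 'X) (alpha i).
  exists q; rewrite -eq_q (derB derDR) DR_F D_alpha DR_X !hornerE.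
  by [].
split.
- exact: constants_of_only_constant_exponentials.
- move=> w; split=> [|[c ->]].
    exact: (constants_of_fraction (e := iotaP) derDE DE_R R_only).
  rewrite -[const_to_frac F _]/(poly_to_frac F (iota c)%:P) DE_R DR_F D_C.
  by rewrite polyC0 rmorph0.
- move=> i; have [q eq_q] := DR_XsubC i.
  have [[_ I0 ID IM] Id] : is_differential_ideal DR (fun=> True)
      (fun x => exists2 t, True & x = t * ('X - (alpha i)%:P)).
    exact: (principal_differential_ideal derDR) eq_q.
  have E x : principal_ideal ('X - (alpha i)%:P) x
      <-> exists2 t, True & x = t * ('X - (alpha i)%:P).
    by split=> [[t ->]|[t _ ->]]; exists t.
  split; first split=> //.
  - exact/E.
  - by move=> x y /E Ix /E Iy; apply/E/ID.
  - by move=> t x _ /E Ix; apply/E/IM.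
  by move=> x /E Ix; apply/E/Id.
move=> T [TC TB TM] fgT TR TD.
have [g nzg gT] := fin_gen_denominator fgT.
have [i nroot] := exists_nonroot (generator_inj alpha_indep) nzg.
pose a := poly_to_frac F ('X - (alpha i)%:P).
have [q eq_q] := DR_XsubC i.
have T0 : T 0 by rewrite -(rmorph0 (poly_to_frac F)).
have TA x y : T x -> T y -> T (x + y).
  by move=> Tx Ty; rewrite -[y]opprK -[- y]sub0r; apply: (TB) => //; apply: (TB).
exists (fun x => exists2 t, T t & x = t * a); split.
- apply: (principal_differential_ideal (q := poly_to_frac F q)) => //.
    exact: TR.
  by rewrite /a DE_R eq_q rmorphM.
- exists a; split; first by exists 1; rewrite ?mul1r // -(rmorph1 (poly_to_frac F)).
  by apply/eqP; rewrite /a /= tofrac_eq0 polyXsubC_eq0.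
move=> properI; have [|t Tt eq1] := (properI 1).1.
  by rewrite -(rmorph1 (poly_to_frac F)).
have [n [p tp]] := gT t Tt.
case/negP: nroot; apply/rootP.
have gn : g ^+ n = p * ('X - (alpha i)%:P).
  apply/eqP; rewrite -tofrac_eq tofracM -tp.
  by rewrite mulrAC -[X in t * X]/a -eq1 mul1r.
have /(congr1 (horner^~ (alpha i))) := gn.
by rewrite !hornerE subrr mulr0 => /eqP; rewrite expf_eq0 => /andP[_ /eqP].
Qed.
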